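(* Let $K$ be an infinite field, $R=K[x_1,\ldots,x_n]$ and $S=K[x_1,\ldots,x_{n-1}]$ with the standard gradings. (a) If $n-d>d\ge 2$, then $$H(R/I^{\rm Sp}_{(n-d,d)},t)=H(S/I^{\rm Sp}_{(n-d-1,d)},t)+\frac{t}{1-t}\,H(S/I^{\rm Sp}_{(n-d,d-1)},t).$$ (b) If $n=2d$ and $d\ge 2$, then $$H(R/I^{\rm Sp}_{(d,d)},t)=H(S/I^{\rm Sp}_{(d-1,d-1,1)},t)+\frac{t}{1-t}\,H(S/I^{\rm Sp}_{(d,d-1)},t).$$
   Context: A partition of $m$ is a sequence $\lambda=(\lambda_1,\ldots,\lambda_l)$ of integers with $\lambda_1\ge\cdots\ge\lambda_l\ge 1$ and $\sum_i\lambda_i=m$. A Young tableau of shape $\lambda$ is a bijective filling of the boxes of the Young diagram of $\lambda$ (row $i$ has $\lambda_i$ boxes, left-justified) with the letters $1,\ldots,m$; $\operatorname{Tab}(\lambda)$ denotes the set of all such tableaux (no monotonicity is required). For $T\in\operatorname{Tab}(\lambda)$, if the $j$-th column of $T$ consists of $j_1,\ldots,j_r$ from top to bottom, put $f_T(j):=\prod_{1\le s<t\le r}(x_{j_s}-x_{j_t})$ (equal to $1$ if the column has one box), and $f_T:=\prod_{j=1}^{\lambda_1}f_T(j)\in K[x_1,\ldots,x_m]$ (the Specht polynomial). The Specht ideal $I^{\rm Sp}_\lambda:=(f_T\mid T\in\operatorname{Tab}(\lambda))$ is an ideal of $K[x_1,\ldots,x_m]$; thus it is an ideal of $R$ when $\lambda$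 is a partition of $n$ and an ideal of $S$ when $\lambda$ is a partition of $n-1$. The Hilbert series of a finitely generated graded module $M$ is $H(M,t)=\sum_i\dim_K[M]_i\,t^i$. *)

(* Defs.v *)
From HB Require Import structures.
From mathcomp Require Import all_boot all_order all_algebra.
From mathcomp Require Import mpoly.
From Stdlib Require Import Classical ClassicalEpsilon.
Set Implicit Arguments. Unset Strict Implicit. Unset Printing Implicit Defensive.
Import GRing.Theory.
Local Open Scope ring_scope.

Definition infinite_field (K : fieldType) : Prop :=
  forall s : seq K, exists x : K, x \notin s.

(** * Specht ideals *)

(* The Young diagram of [la] (rows and columns are numbered from 0). *)
Definition box (la : seq nat) : finType :=
  {i : 'I_(size la) & 'I_(nth 0%N la i)}.

Definition row_of (la : seq nat) (b : box la) : nat := tag b.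
Definition col_of (la : seq nat) (b : box la) : nat := tagged b.

(* Bijective fillings of the diagram by the indices of the [m] variables. The
   definition is only meant for [la] a partition of [m]. *)
Definition tableau (m : nat) (la : seq nat) : finType :=
  {T : {ffun box la -> 'I_m} | injectiveb T && [forall k, k \in codom T]}.

Section Specht.
Variables (K : fieldType) (m : nat) (la : seq nat).

Definition specht_column (T : tableau m la) (j : nat) : {mpoly K[m]} :=
  \prod_(p : box la * box la |
      [&& col_of p.1 == j, col_of p.2 == j & (row_of p.1 < row_of p.2)%N])
    ('X_(val T p.1) - 'X_(val T p.2)).

(* [head 0 la] is the number of columns. *)
Definition specht_poly (T : tableau m la) : {mpoly K[m]} :=
  \prod_(j < head 0%N la) specht_column T j.

Definition specht_ideal (p : {mpoly K[m]}) : Prop :=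
  exists c : tableau m la -> {mpoly K[m]}, p = \sum_T c T * specht_poly T.

End Specht.
Arguments specht_ideal : clear implicits.

(** * Formal power series over the integers *)

Definition fps : Type := nat -> int.

Definition fps_one : fps := fun i => (i == 0%N)%:R.
Definition fps_t : fps := fun i => (i == 1%N)%:R.
Definition fps_add (f g : fps) : fps := fun i => f i + g i.
Definition fps_sub (f g : fps) : fps := fun i => f i - g i.
Definition fps_mul (f g : fps) : fps :=
  fun i => \sum_(j < i.+1) f j * g (i - j)%N.

(* The series 1 / (1 - t), see [fps_geomP]. *)
Definition fps_geom : fps := fun=> 1.

Lemma fps_geomP : fps_mul (fps_sub fps_one fps_t) fps_geom =1 fps_one.
Proof.
rewrite /fps_mul /fps_sub /fps_one /fps_t /fps_geom => -[|i].
  by rewrite big_ord1 /= subr0 mulr1.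
rewrite 2!big_ord_recl /= big1 => [|j _]; last by rewrite subrr mul0r.
by rewrite subr0 sub0r !mulr1 addr0 subrr.
Qed.

(** * Hilbert series of a graded quotient *)

Section Hilbert.
Variables (K : fieldType) (m : nat).
Implicit Types (I : {mpoly K[m]} -> Prop) (i h : nat).

(* The classes modulo [I] of [b 0], .., [b (h - 1)] form a basis of the
   degree [i] component of K[x_1, .., x_m] / I. *)
Definition quot_basis I i h (b : 'I_h -> {mpoly K[m]}) : Prop :=
  [/\ forall k, b k \is i.-homog,
      forall c : 'I_h -> K, I (\sum_k c k *: b k) -> forall k, c k = 0
    & forall p : {mpoly K[m]}, p \is i.-homog ->
        exists c : 'I_h -> K, I (p - \sum_k c k *: b k)].

Definition quot_dim_is I i h : Prop :=
  exists b : 'I_h -> {mpoly K[m]}, quot_basis I i b.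

(* This is meant for [I] an ideal; [quot_dimP] then says that the choice made
   by [epsilon] exists and is unique. *)
Definition quot_dim I i : nat := epsilon (inhabits 0%N) (quot_dim_is I i).

Definition hilbert_series I : fps := fun i => (quot_dim I i)%:Z.

Section QuotDim.
Variable I : {mpoly K[m]} -> Prop.
Hypothesis I0 : I 0.
Hypothesis ID : forall p q, I p -> I q -> I (p + q).
Hypothesis IZ : forall (a : K) p, I p -> I (a *: p).

Let I_sum (J : finType) (F : J -> {mpoly K[m]}) :
  (forall j, I (F j)) -> I (\sum_j F j).
Proof. by move=> IF; apply: (big_ind I). Qed.

Let free_le_span h g (b : 'I_h -> {mpoly K[m]}) (e : 'I_g -> {mpoly K[m]}) :
  (forall c : 'I_h -> K, I (\sum_k c k *: b k) -> forall k, c k = 0) ->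
  (forall k, exists c : 'I_g -> K, I (b k - \sum_l c l *: e l)) ->
  (h <= g)%N.
Proof.
move=> bfree bspan.
have [A Ab] : exists A : 'I_h -> 'I_g -> K,
    forall k, I (b k - \sum_l A k l *: e l).
  exists (fun k => proj1_sig (constructive_indefinite_description _ (bspan k))).
  by move=> k; case: constructive_indefinite_description.
pose M := \matrix_(k, l) A k l.
rewrite leqNgt; apply/negP => lt_gh.
have : kermx M != 0.
  rewrite -mxrank_eq0 mxrank_ker subn_eq0 -ltnNge.
  exact: leq_ltn_trans (rank_leq_col M) lt_gh.
case/rowV0Pn => v /sub_kermxP vM /eqP; apply; apply/rowP => k; rewrite mxE.
apply: (bfree (v 0)) => {k}.
have -> : \sum_k v 0 k *: b k = \sum_k v 0 k *: (b k - \sum_l A k l *: e l).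
  apply/eqP; rewrite -subr_eq0 -sumrB; apply/eqP.
  transitivity (\sum_l (v *m M) 0 l *: e l); last first.
    by rewrite vM big1 // => l _; rewrite mxE scale0r.
  transitivity (\sum_k \sum_l (v 0 k * A k l) *: e l).
    apply: eq_bigr => k _; rewrite scalerBr opprB addrC subrK scaler_sumr.
    by apply: eq_bigr => l _; rewrite scalerA.
  rewrite exchange_big; apply: eq_bigr => l _; rewrite mxE scaler_suml.
  by apply: eq_bigr => k _; rewrite mxE.
by apply: I_sum => k; apply: IZ.
Qed.

Lemma quot_dim_uniq i h g : quot_dim_is I i h -> quot_dim_is I i g -> h = g.
Proof.
move=> [b [bh bf bs]] [e [eh ef es]]; apply/eqP; rewrite eqn_leq.
by apply/andP; split; [apply: (free_le_span bf) => k; apply: es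
                      | apply: (free_le_span ef) => k; apply: bs].
Qed.

Lemma quot_dim_exists i : exists h, quot_dim_is I i h.
Proof.
pose fr h := exists b : 'I_h -> {mpoly K[m]}, (forall k, b k \is i.-homog) /\
  forall c : 'I_h -> K, I (\sum_k c k *: b k) -> forall k, c k = 0.
pose N := #|{: 'X_{1..m < i.+1}}|.
have fr_le h : fr h -> (h <= N)%N.
  case=> b [bh bf].
  pose ev (l : 'I_N) : 'X_{1..m < i.+1} := enum_val l.
  apply: (free_le_span (e := fun l => 'X_[ev l]) bf) => k.
  exists (fun l => (b k)@_(ev l)).
  rewrite {1}(mpolywE (k := i.+1) (p := b k)); last first.
    rewrite mmeasureE; apply/bigmax_leqP_seq => mn mnk _.
    by move/dhomogP: (bh k) => /(_ mn mnk) ->.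
  rewrite (reindex_onto ev enum_rank) /=; last first.
    by move=> j _; rewrite /ev enum_rankK.
  rewrite (eq_bigl xpredT); last by move=> l; rewrite /ev enum_valK eqxx.
  by rewrite subrr.
have fr0 : fr 0%N.
  by exists (fun=> 0); split => [[]|c _ []].
have [h [frh hmax]] : exists h, fr h /\ ~ fr h.+1.
  apply: NNPP => H.
  have all_fr k : fr k.
    by elim: k => // k frk; apply: NNPP => nfr; apply: H; exists k.
  by have := fr_le _ (all_fr N.+1); rewrite ltnn.
case: frh => b [bh bf]; exists h, b; split=> // p ph; apply: NNPP => nspan.
apply: hmax.
exists (fun k => if unlift ord0 k is Some l then b l else p); split.
  by move=> k; case: unliftP.
move=> c; rewrite big_ord_recl unlift_none => Ic.
have Ec : \sum_k c (lift ord0 k) *: (if unlift ord0 (lift ord0 k) is Some l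
    then b l else p) = \sum_k c (lift ord0 k) *: b k.
  by apply: eq_bigr => k _; rewrite liftK.
rewrite Ec in Ic.
have [c0|c0] := eqVneq (c ord0) 0.
  move: Ic; rewrite c0 scale0r add0r => /(bf (fun k => c (lift ord0 k))) cl k.
  by case: (unliftP ord0 k) => [l|] -> //.
case: nspan; exists (fun k => - ((c ord0)^-1 * c (lift ord0 k))).
have := IZ (c ord0)^-1 Ic; rewrite scalerDr scalerA mulVf // scale1r.
rewrite scaler_sumr; congr (I (_ + _)); rewrite -sumrN.
by apply: eq_bigr => k _; rewrite scalerA scaleNr opprK.
Qed.

Lemma quot_dimP i h : quot_dim_is I i h <-> quot_dim I i = h.
Proof.
have H := epsilon_spec (inhabits 0%N) _ (quot_dim_exists i).
by split=> [/(quot_dim_uniq H)|<-].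
Qed.

End QuotDim.
End Hilbert.

Lemma specht_quot_dimP (K : fieldType) (m : nat) (la : seq nat) (i h : nat) :
  quot_dim_is (specht_ideal K m la) i h
  <-> quot_dim (specht_ideal K m la) i = h.
Proof.
apply: quot_dimP => [|p q [c ->] [e ->]|a p [c ->]].
- by exists (fun=> 0); rewrite big1 // => T _; rewrite mul0r.
- exists (fun T => c T + e T); rewrite -big_split.
  by apply: eq_bigr => T _; rewrite mulrDl.
- exists (fun T => a *: c T); rewrite scaler_sumr.
  by apply: eq_bigr => T _; rewrite scalerAl.
Qed.

(* Main.v *)
Require Import Defs.
From mathcomp Require Import all_boot all_order all_algebra.
From mathcomp Require Import mpoly zify ring.
From Stdlib Require Import Classical.
Set Implicit Arguments. Unset Strict Implicit. Unset Printing Implicit Defensive.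
Import Order.TTheory GRing.Theory.
Local Open Scope ring_scope.

(** Every Specht ideal in the statement is a vanishing ideal.  Call a point of
    K^m k-heavy if some value occurs more than k times among its coordinates,
    and let V(m, k) be the ideal of the polynomials in m variables that vanish
    at all k-heavy points.  If the columns of [la] have lengths that differ by
    at most one, and there are k of them, then the Specht ideal of [la] is
    V(m, k) ([specht_idealE]).  The shapes (a, b) with b <= a have k = a, and
    the shape (d - 1, d - 1, 1) has k = d - 1, so with k = n - d in
    both parts the claim becomes, for n + 1 variables in place of n,
      H(V(n + 1, k)) = H(V(n, k - 1)) + t / (1 - t) H(V(n, k)),
    where H(V) is the Hilbert series of the quotient by V.

    This is a count by powers of the last variable y ([quot_dim_recursion]).
    Filter the polynomials by their degree in y.  A polynomial without y lies
    in V(n + 1, k) iff it lies in V(n, k - 1), since a (k - 1)-heavy point can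
    be extended by its frequent value.  All y-coefficients of an element of
    V(n + 1, k) lie in V(n, k), since y may take infinitely many values on a
    k-heavy point.  Conversely each a in V(n, k) has a b such that y a + b is
    in V(n + 1, k): if a = f_T, and some column of T is a single box filled
    with i, take b = - x_i f_T.  So the leading coefficients that occur in
    V(n + 1, k) in y-degree j form V(n, k - 1) for j = 0 and V(n, k) for
    every j >= 1.

    The identification of the Specht ideals has two steps.
    - Colour the m indices with k colours, and let the polynomial of a
      colouring be the product of the Vandermonde polynomials of its colour
      classes.  These polynomials generate V(m, k), a theorem of Li and Li
      ([vanishes_heavy_color]).  Given f <> 0 with leading monomial x^a, choose
      the coordinates of a point v from the last one to the first: each time,
      take the most frequent earlier value that keeps f from vanishing.  As
      at most a_i values are forbidden at index i, the colouring of i by the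
      number of later repetitions of v_i has a polynomial with leading monomial
      dividing x^a.  If f is in V(m, k), then f(v) <> 0 shows that at most k
      colours occur, and f can be reduced.
    - Lagrange interpolation expresses the product of two Vandermonde
      polynomials on X and Y with |X| > |Y| through the products obtained by
      moving one element of X to Y ([vdm_exchange]).  Hence the colourings
      with any prescribed balanced class sizes suffice, and those whose class
      sizes are the column lengths of [la] give Specht polynomials. *)

(** * Choices in an infinite field *)

Lemma infinite_field_uniq (K : fieldType) (Kinf : infinite_field K)
    (s : seq K) (n : nat) :
  exists r : seq K, [/\ size r = n, uniq r & all (fun x => x \notin s) r].
Proof.
elim: n => [|n [r [sz ur ra]]]; first by exists [::].
have [x] := Kinf (r ++ s); rewrite mem_cat negb_or => /andP[xr xs].
by exists (x :: r); rewrite /= sz xr ur xs ra.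
Qed.

Lemma infinite_field_nonroot (K : fieldType) (Kinf : infinite_field K)
    (s : seq K) (P : {poly K}) :
  P != 0 -> exists2 x, x \notin s & P.[x] != 0.
Proof.
move=> P0; have [r [sz ur ra]] := infinite_field_uniq Kinf s (size P).
have : ~~ all (root P) r.
  by apply/negP => /(max_poly_roots P0)/(_ ur); rewrite sz ltnn.
by case/allPn => x xr nx; exists x; [exact: (allP ra) | exact: nx].
Qed.

Lemma exists_argmax (T : Type) (Q : T -> Prop) (h : T -> nat) (b : nat) :
  (forall x, (h x <= b)%N) -> (exists x, Q x) ->
  exists x, Q x /\ forall y, Q y -> (h y <= h x)%N.
Proof.
move=> hb [x0]; move: {2}(b - h x0)%N (erefl (b - h x0)%N) => n.
elim/ltn_ind: n x0 => n IH x En Qx.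
have [mx|nmx] := classic (forall y, Q y -> (h y <= h x)%N).
  by exists x.
have [y nqy] := not_all_ex_not _ _ nmx.
have [Qy /negP] := imply_to_and _ _ nqy.
rewrite -ltnNge => lt; apply: (IH (b - h y)%N _ y) => //.
by rewrite -En ltn_sub2l // (leq_trans lt).
Qed.

(** * Heavy points *)

Section Points.
Variables (K : fieldType) (m : nat).
Implicit Types (v : 'I_m -> K) (f p q : {mpoly K[m]}).

Definition multiplicity v (x : K) : nat := #|[pred i | v i == x]|.

Lemma eq_multiplicity v w x : v =1 w -> multiplicity v x = multiplicity w x.
Proof. by move=> E; apply: eq_card => i; rewrite !inE E. Qed.

Definition vanishes_heavy (k : nat) p : Prop :=
  forall v x, (k < multiplicity v x)%N -> p.@[v] = 0.

Definition is_ideal (I : {mpoly K[m]} -> Prop) : Prop :=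
  [/\ I 0, forall p q, I p -> I q -> I (p + q) & forall p q, I q -> I (p * q)].

Lemma ideal_sum I (J : Type) (r : seq J) (P : pred J) (F : J -> {mpoly K[m]}) :
  is_ideal I -> (forall j, P j -> I (F j)) -> I (\sum_(j <- r | P j) F j).
Proof. by case=> I0 ID _ IF; apply: (big_ind I). Qed.

Lemma ideal_vanishes_heavy k : is_ideal (vanishes_heavy k).
Proof.
split=> [v x _|p q Ip Iq v x lt|p q Iq v x lt]; first exact: meval0.
  by rewrite mevalD (Ip _ _ lt) (Iq _ _ lt) addr0.
by rewrite mevalM (Iq _ _ lt) mulr0.
Qed.

(** The restriction of [f] to the line through [v]: its coefficients are the
    values at [v] of the homogeneous components of [f]. *)
Definition scale_poly f v : {poly K} :=
  \sum_(b <- msupp f) (f@_b * \prod_i v i ^+ b i) *: 'X^(mdeg b).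

Lemma horner_scale_poly f v t :
  (scale_poly f v).[t] = f.@[fun i => t * v i].
Proof.
rewrite horner_sum mevalE; apply: eq_bigr => b _.
rewrite hornerZ hornerXn -mulrA; congr (_ * _).
rewrite mdegE (big_morph _ (exprD t) (expr0 t)) mulrC -big_split.
by apply: eq_bigr => i _; rewrite exprMn.
Qed.

Lemma coef_scale_poly f v d :
  (scale_poly f v)`_d = (pihomog mdeg d f).@[v].
Proof.
rewrite coef_sum pihomogE raddf_sum /= [RHS]big_mkcond.
apply: eq_bigr => b _; rewrite coefZ coefXn eq_sym.
case: eqP => _; last by rewrite mulr0.
by rewrite mulr1 mevalZ mevalX.
Qed.

Lemma multiplicity_scale v t x : t != 0 ->
  multiplicity (fun i => t * v i) (t * x) = multiplicity v x.
Proof.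
move=> t0; apply: eq_card => i; rewrite !inE.
by rewrite (inj_eq (mulfI t0)).
Qed.

(** The set of heavy points is a cone. *)
Lemma vanishes_heavy_pihomog (Kinf : infinite_field K) k f d :
  vanishes_heavy k f -> vanishes_heavy k (pihomog mdeg d f).
Proof.
move=> Vf v x lt; rewrite -coef_scale_poly.
have [->|/(infinite_field_nonroot Kinf [:: 0])[t]] := eqVneq (scale_poly f v) 0.
  by rewrite coef0.
rewrite inE => t0; rewrite horner_scale_poly (Vf _ (t * x)) ?eqxx //.
by rewrite multiplicity_scale.
Qed.

(** * Colourings and the polynomials vanishing at heavy points *)

Definition color_poly (T : eqType) (chi : 'I_m -> T) : {mpoly K[m]} :=
  \prod_(p : 'I_m * 'I_m | (p.1 < p.2)%N && (chi p.1 == chi p.2))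
    ('X_p.1 - 'X_p.2).

(** Pigeonhole: two of the equal coordinates have indices of the same colour. *)
Lemma color_poly_vanishes k (chi : 'I_m -> 'I_k) :
  vanishes_heavy k (color_poly chi).
Proof.
move=> v x lt; pose S := [pred i | v i == x].
have : ~~ dinjectiveb chi S.
  apply/negP => /dinjectiveP /card_in_image E.
  have := max_card (mem [seq chi i | i in S]).
  by rewrite E card_ord leqNgt lt.
case/dinjectivePn => i Si [j]; rewrite !inE in Si * => /andP[ji Sj] cij.
wlog ltij : i j Si Sj ji cij / (i < j)%N.
  move=> W; have [] := ltngtP i j; first exact: W.
    by move=> ltji; apply: (W j i) => //; rewrite eq_sym.
  by move/val_inj => eij; rewrite eij eqxx in ji.
rewrite /color_poly (bigD1 (i, j)) /= ?ltij ?cij ?eqxx //.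
by rewrite mevalM mevalB !mevalXU (eqP Si) (eqP Sj) subrr mul0r.
Qed.

Lemma mlead_subX (i j : 'I_m) : (i < j)%N ->
  mlead ('X_i - 'X_j : {mpoly K[m]}) = U_(i)%MM.
Proof.
move=> lt; rewrite mleadDl ?mleadXm // mleadN !mleadXm.
apply/ltmcP; rewrite ?mdeg1 //; exists i.
  move=> l ltl; rewrite !mnm1E.
  by rewrite -!val_eqE /= !gtn_eqF // (ltn_trans ltl).
by rewrite !mnm1E eqxx -val_eqE /= gtn_eqF.
Qed.

Lemma subX_neq0 (i j : 'I_m) : (i < j)%N -> 'X_i - 'X_j != 0 :> {mpoly K[m]}.
Proof.
move=> lt; apply: contraTneq (lt) => E.
have := mlead_subX lt; rewrite E mlead0 => /mnmP/(_ i).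
by rewrite mnm0E mnm1E eqxx.
Qed.

Lemma color_poly_neq0 (T : eqType) (chi : 'I_m -> T) : color_poly chi != 0.
Proof. by apply/prodf_neq0 => -[i j] /andP[lt _]; apply: subX_neq0. Qed.

Lemma mlead_color_poly (T : eqType) (chi : 'I_m -> T) i :
  mlead (color_poly chi) i = #|[pred j : 'I_m | (i < j)%N && (chi j == chi i)]|.
Proof.
rewrite /color_poly mlead_prod; last first.
  by move=> [a b] _ /andP[lt _]; apply: subX_neq0.
rewrite (eq_bigr (fun e : 'I_m * 'I_m => U_(e.1)%MM)); last first.
  by move=> [a b] /andP[lt _]; apply: mlead_subX.
rewrite mnm_sumE -sum1_card.
rewrite -(pair_big_dep (fun=> true)
  (fun a b : 'I_m => (a < b)%N && (chi a == chi b)) (fun a b => U_(a)%MM i)) /=.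
rewrite (bigD1 i) //= [X in (_ + X)%N]big1 ?addn0; last first.
  by move=> a ai; rewrite big1 // => b _; rewrite mnm1E (negbTE ai).
rewrite mnm1E eqxx; apply: eq_bigl => b; rewrite inE.
by rewrite [chi b == _]eq_sym.
Qed.

(** Indices are compared from the last to the first: in the monomial order the
    first variable is the largest, so the leading coefficient with respect to
    variable [i] involves the later variables only. *)
Definition occ v (i : 'I_m) : nat :=
  #|[pred j : 'I_m | (i < j)%N && (v j == v i)]|.

Lemma occ_lt_multiplicity v i : (occ v i < multiplicity v (v i))%N.
Proof.
apply: proper_card; apply/properP; split.
  by apply/subsetP => j; rewrite !inE => /andP[].
by exists i; rewrite !inE ?eqxx // ltnn.
Qed.

Lemma occ_lt v (i j : 'I_m) : (i < j)%N -> v i = v j -> (occ v j < occ v i)%N.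
Proof.
move=> ij E; apply: proper_card; apply/properP; split.
  by apply/subsetP => l; rewrite !inE E => /andP[jl ->]; rewrite (ltn_trans ij).
by exists j; rewrite !inE ?ltnn // ij E eqxx.
Qed.

Lemma eq_occ v w (i : 'I_m) :
  (forall j l : 'I_m, (i <= j)%N -> (i <= l)%N -> (w j == w l) = (v j == v l)) ->
  occ w i = occ v i.
Proof.
move=> E; apply: eq_card => j; rewrite !inE.
by case: ltnP => //= ij; rewrite E // ltnW.
Qed.

(** The colouring [occ v] contributes to its leading monomial, at [i], the
    number of later indices of the same colour, see [mlead_color_poly]. *)
Definition dominated (a : 'X_{1..m}) v (i : 'I_m) : bool :=
  (#|[pred j : 'I_m | (i < j)%N && (occ v j == occ v i)]| <= a i)%N.

Lemma eq_dominated a v w (i : 'I_m) :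
  (forall j l : 'I_m, (i <= j)%N -> (i <= l)%N -> (w j == w l) = (v j == v l)) ->
  dominated a v i -> dominated a w i.
Proof.
move=> E; rewrite /dominated; apply: leq_trans; apply: subset_leq_card.
apply/subsetP => j; rewrite !inE => /andP[ij].
rewrite ij (eq_occ E) (@eq_occ v w j) // => j' l jj' jl.
by apply: E; apply: ltnW; apply: leq_trans ij _.
Qed.

Definition agree (j : nat) (a b : 'X_{1..m}) : bool :=
  (mdeg b == mdeg a) && [forall i : 'I_m, (i < j)%N ==> (b i == a i)].

(** The part of [f] that agrees with the leading monomial in the variables
    before [j], stripped of these variables and evaluated at [v].  For [j = m]
    this is the leading coefficient, and for [j = 0] it is the value of the
    homogeneous component of top degree. *)
Definition lead_tail f (j : nat) v : K :=
  \sum_(b <- msupp f | agree j (mlead f) b)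
    f@_b * \prod_(i : 'I_m | (j <= i)%N) v i ^+ b i.

Lemma agreeS (i : 'I_m) a b : agree i.+1 a b = agree i a b && (b i == a i).
Proof.
rewrite /agree -andbA; congr (_ && _); apply/forallP/andP.
  move=> H; split; last by have := H i; rewrite ltnSn.
  by apply/forallP => l; apply/implyP => li; apply: (implyP (H l)); rewrite ltnW.
case=> /forallP H E l; apply/implyP; rewrite ltnS leq_eqVlt.
by case/predU1P => [/val_inj->//|]; apply/implyP.
Qed.

Lemma agree_le (i : 'I_m) f b :
  b \in msupp f -> agree i (mlead f) b -> (b i <= mlead f i)%N.
Proof.
move=> bf /andP[/eqP db /forallP ag].
have := msupp_le_mlead bf; rewrite le_eqVlt => /predU1P[->//|].
case/(ltmcP db) => l eql ltl; have [il|li|/val_inj->] := ltngtP i l.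
- by rewrite eql.
- by have := implyP (ag l) li; rewrite ltn_eqF.
- exact: ltnW.
Qed.

(** The choice of one coordinate.  As a polynomial in coordinate [i], the tail
    has degree [mlead f i], so it has at most that many roots.  The values used
    more often than the most frequent non-root are all roots, and the later
    indices with the colour of [i] inject into these values. *)
Lemma lead_tailS (Kinf : infinite_field K) f (i : 'I_m) v :
  lead_tail f i.+1 v != 0 ->
  exists w, [/\ lead_tail f i w != 0, forall j : 'I_m, (i < j)%N -> w j = v j
              & dominated (mlead f) w i].
Proof.
move=> nz; set a := mlead f in nz *.
pose P : {poly K} := \sum_(b <- msupp f | agree i a b)
  (f@_b * \prod_(j : 'I_m | (i < j)%N) v j ^+ b j) *: 'X^(b i).
pose w x j := if j == i then x else v j.
have wP x : lead_tail f i (w x) = P.[x].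
  rewrite horner_sum; apply: eq_bigr => b _; rewrite hornerZ hornerXn -mulrA.
  congr (_ * _); rewrite (bigD1 i) //= mulrC /w eqxx; congr (_ * _).
  apply: eq_big => [j|j /andP[_ /negbTE->]] //.
  by rewrite andbC ltn_neqAle -val_eqE eq_sym.
have Pa : P`_(a i) = lead_tail f i.+1 v.
  rewrite coef_sum [RHS](eq_bigl (fun b => agree i a b && (b i == a i))).
    rewrite [RHS]big_mkcondr; apply: eq_bigr => b _.
    by rewrite coefZ coefXn eq_sym; case: eqP; rewrite ?mulr1 ?mulr0.
  by move=> b; rewrite agreeS.
have P0 : P != 0 by apply: contraNneq nz => E; rewrite -Pa E coef0.
have sP : (size P <= (a i).+1)%N.
  rewrite /P big_seq_cond; apply: (big_ind (fun p : {poly K} => size p <= (a i).+1)%N).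
  - by rewrite size_poly0.
  - move=> p q sp sq; apply: leq_trans (size_polyD _ _) _.
    by rewrite geq_max sp.
  move=> b /andP[bf ag].
  apply: leq_trans (size_scale_leq _ _) _; rewrite size_polyXn ltnS.
  exact: agree_le ag.
pose h x := #|[pred j : 'I_m | (i < j)%N && (v j == x)]|.
have [||x [nx xmax]] :=
  @exists_argmax K (fun x => P.[x] != 0) h m.
- by move=> x; rewrite -[X in (_ <= X)%N]card_ord max_card.
- by have [x _ nx] := infinite_field_nonroot Kinf [::] P0; exists x.
exists (w x); split; first by rewrite wP.
  by move=> j ij; rewrite /w -val_eqE gtn_eqF.
have wv (j : 'I_m) : (i < j)%N -> w x j = v j.
  by move=> ij; rewrite /w -val_eqE gtn_eqF.
have oi : occ (w x) i = h x.
  apply: eq_card => j; rewrite !inE; case: ltnP => //= ij.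
  by rewrite wv // /w eqxx.
have oj (j : 'I_m) : (i < j)%N -> occ (w x) j = occ v j.
  by move=> ij; apply: eq_occ => l l' jl jl'; rewrite !wv // (leq_trans ij).
rewrite /dominated; set D := [pred j | _].
have DP j : j \in D -> (i < j)%N /\ occ v j = h x.
  by rewrite inE => /andP[ij]; rewrite oj // oi => /eqP.
have injD : {in D &, injective v}.
  move=> j l /DP[_ oj'] /DP[_ ol] E; apply/val_inj; apply/eqP.
  case: ltngtP => // lt.
    by have := occ_lt lt E; rewrite oj' ol ltnn.
  by have := occ_lt lt (esym E); rewrite oj' ol ltnn.
(* The values at the indices in D occur more than h x times, so they are roots
   by the maximality of x. *)
have := max_poly_roots P0 (rs := image v D).
rewrite size_image => H; rewrite -ltnS; apply: leq_trans sP; apply: H; last first.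
  by rewrite map_inj_in_uniq ?enum_uniq // => j l; rewrite !mem_enum; apply: injD.
apply/allP => _ /imageP[j Dj ->]; have [ij oE] := DP j Dj.
rewrite /root; apply/negPn/negP => /xmax; rewrite leqNgt => /negP; apply.
rewrite -oE; apply: proper_card; apply/properP; split.
  apply/subsetP => l; rewrite !inE => /andP[jl ->].
  by rewrite (ltn_trans ij).
by exists j; rewrite !inE ?ltnn // ij eqxx.
Qed.

Lemma dominated_point (Kinf : infinite_field K) f : f != 0 ->
  exists v, f.@[v] != 0 /\ forall i, dominated (mlead f) v i.
Proof.
move=> f0.
have H k : (k <= m)%N -> exists v, lead_tail f (m - k) v != 0 /\
    forall i : 'I_m, (m - k <= i)%N -> dominated (mlead f) v i.
  elim: k => [_|k IH lt].
    exists (fun=> 0); split; last by move=> i; rewrite subn0 leqNgt ltn_ord.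
    rewrite subn0 /lead_tail (eq_bigl (pred1 (mlead f))); last first.
      move=> b; rewrite /agree /=; apply/andP/eqP => [[_ /forallP ag]|->].
        by apply/mnmP => i; apply/eqP/(implyP (ag i)).
      by split=> //; apply/forallP => i; rewrite eqxx implybT.
    rewrite big_mkcond (bigD1_seq (mlead f)) ?msupp_uniq ?mlead_supp //=.
    rewrite eqxx [X in _ + X]big1 ?addr0 => [|b /negbTE->//].
    rewrite big1 ?mulr1 ?mleadc_eq0 // => i.
    by rewrite leqNgt ltn_ord.
  have [v [nz dom]] := IH (ltnW lt).
  have lti : (m - k.+1 < m)%N by rewrite ltn_subrL (leq_trans _ lt).
  pose i := Ordinal lti; have iE : (m - k)%N = i.+1 by rewrite /= -subSn.
  rewrite iE in nz dom; have [w [nzw wv dw]] := lead_tailS Kinf nz.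
  exists w; split=> // j; rewrite leq_eqVlt => /predU1P[E|ij].
    by have -> : j = i by apply: val_inj.
  apply: eq_dominated (dom j ij) => l l' jl jl'.
  by rewrite !wv // (leq_trans ij).
have [v []] := H m (leqnn m); rewrite subnn => nz dom.
(* The construction only controls the component of top degree; a suitable
   multiple of v is not a zero of f itself. *)
have Q0 : scale_poly f v != 0.
  apply: contraNneq nz => E; move: (coef_scale_poly f v (mdeg (mlead f))).
  rewrite E coef0 pihomogE raddf_sum /= => /esym/eqP; congr (_ == _).
  apply: eq_big => [b|b _]; last first.
    by rewrite mevalZ mevalX; congr (_ * _); apply: eq_bigl.
  by rewrite /agree [X in _ = _ && X](_ : _ = true) ?andbT //; apply/forallP.
have [t t0 nt] := infinite_field_nonroot Kinf [:: 0] Q0.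
rewrite inE in t0; exists (fun i => t * v i); rewrite -horner_scale_poly.
split=> // i; apply: eq_dominated (dom i isT) => j l _ _.
by rewrite (inj_eq (mulfI t0)).
Qed.

(** Reduction by induction on the leading monomial: a point as in
    [dominated_point] is not heavy, so its colouring [occ v] uses only [k]
    colours. *)
Theorem vanishes_heavy_color (Kinf : infinite_field K) k I :
  is_ideal I -> (forall chi : 'I_m -> 'I_k, I (color_poly chi)) ->
  forall f, vanishes_heavy k f -> I f.
Proof.
move=> Iid Ichi; elim/mleadrect => f IH Vf.
have [->|f0] := eqVneq f 0; first by case: Iid.
have [v [nz dom]] := dominated_point Kinf f0.
have occ_k i : (occ v i < k)%N.
  apply: leq_trans (occ_lt_multiplicity v i) _; rewrite leqNgt.
  by apply: contraNN nz => /Vf ->.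
pose chi i := Ordinal (occ_k i).
pose g := color_poly chi; set a := mlead f.
have ga : (mlead g <= a)%MM.
  apply/mnm_lepP => i; rewrite mlead_color_poly; apply: leq_trans (dom i).
  by rewrite subset_leq_card //; apply/subsetP => j; rewrite !inE.
have g0 : g != 0 by apply: color_poly_neq0.
pose h : {mpoly K[m]} := (mleadc f / mleadc g) *: 'X_[a - mlead g].
have c0 : mleadc f / mleadc g != 0.
  by rewrite mulf_neq0 ?invr_eq0 // mleadc_eq0.
have hl : mlead (h * g) = a.
  rewrite mleadM // ?mleadZ ?mleadXm ?submK // scaler_eq0 negb_or c0.
  by rewrite -mleadc_eq0 mleadXm mcoeffX eqxx oner_eq0.
have hc : (h * g)@_a = f@_a.
  have := mleadcM h g; rewrite {1}/h mleadZ // mleadXm submK // => ->.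
  by rewrite mcoeffZ mcoeffX eqxx mulr1 divfK // mleadc_eq0.
have [Iz ID IM] := Iid.
have -> : f = (f - h * g) + h * g by rewrite subrK.
apply: (ID); last by apply: IM; apply: Ichi.
have [->//|fh0] := eqVneq (f - h * g) 0.
apply: IH; last first.
  have [_ VD VM] := ideal_vanishes_heavy k; apply: VD => //.
  by rewrite -mulNr; apply: VM; apply: color_poly_vanishes.
have := mleadB_le f (h * g); rewrite hl joinxx le_eqVlt => /predU1P[E|//].
by move: fh0; rewrite -mleadc_eq0 E mcoeffB hc subrr eqxx.
Qed.
End Points.

(** * Exchange between two Vandermonde products *)

Section Vandermonde.
Variables (R : idomainType) (m : nat) (z : 'I_m -> R).
Implicit Types (X Y : {set 'I_m}).

Definition vdm X : R :=
  \prod_(i in X) \prod_(j in X | (i < j)%N) (z i - z j).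

Definition vdm_sign X (x : 'I_m) : R :=
  (-1) ^+ #|[set y in X | (y < x)%N]|.

Lemma vdm_signK X x : vdm_sign X x * vdm_sign X x = 1.
Proof. by rewrite -expr2 sqrr_sign. Qed.

Lemma vdmD1 X x : x \in X ->
  vdm X = vdm_sign X x * vdm (X :\ x) * \prod_(y in X :\ x) (z x - z y).
Proof.
move=> Xx; rewrite /vdm (bigD1 x) //=.
rewrite [X in _ * X](eq_bigr (fun i : 'I_m => (if (i < x)%N then z i - z x else 1) *
   \prod_(j in X :\ x | (i < j)%N) (z i - z j))); last first.
  move=> i /andP[Xi ix]; case: ifP => lt.
    rewrite (bigD1 x) ?Xx ?lt //=; congr (_ * _).
    by apply: eq_bigl => j; rewrite !inE; case: (j == x); rewrite /= ?andbF ?andbT.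
  rewrite mul1r; apply: eq_bigl => j; rewrite !inE.
  by case: eqP => [->|]; rewrite ?lt ?andbF.
rewrite big_split /= mulrA [RHS]mulrAC; congr (_ * _); last first.
  by apply: eq_bigl => i; rewrite !inE andbC.
rewrite [in RHS](bigID (fun y : 'I_m => (x < y)%N)) /=.
rewrite mulrCA; congr (_ * _).
  apply: eq_bigl => j; rewrite !inE; case: eqP => [->|] //=.
  by rewrite ltnn andbF.
rewrite -big_mkcondr /= /vdm_sign -prodr_const.
pose P := [pred y : 'I_m | (y \in X) && (y < x)%N].
have ltP (y : 'I_m) : (y < x)%N -> y != x by move=> lt; rewrite -val_eqE ltn_eqF.
rewrite (eq_bigl P) => [|y]; last first.
  by rewrite /= -andbA; case: ltnP => [/ltP->|]; rewrite ?andbF.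
rewrite [X in _ = X * _](eq_bigl P) => [|y]; last by rewrite inE.
rewrite [X in _ = _ * X](eq_bigl P) => [|y].
  by rewrite -big_split /=; apply: eq_bigr => y _; rewrite mulN1r opprB.
by rewrite !inE /= -val_eqE /=; case: ltngtP; rewrite /= ?andbF ?andbT.
Qed.

(** Lagrange interpolation of [q] at the points of [X], cleared of
    denominators and read off at the top coefficient. *)
Lemma vdm_lagrange (zinj : injective z) X (q : {poly R}) :
  q \is monic -> size q = #|X| ->
  vdm X = \sum_(x in X) q.[z x] * vdm_sign X x * vdm (X :\ x).
Proof.
move=> qm sq; set s := #|X| in sq.
have s0 : (0 < s)%N by rewrite -sq size_poly_gt0 monic_neq0.
pose L x : {poly R} := \prod_(y in X :\ x) ('X - (z y)%:P).
have sL x : x \in X -> size (L x) = s.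
  by move=> Xx; rewrite /L -big_enum size_prod_XsubC -cardE /s (cardsD1 x X) Xx.
have Lm x : L x \is monic by apply: monic_prod_XsubC.
pose Q : {poly R} :=
  vdm X *: q - \sum_(x in X) (q.[z x] * vdm_sign X x * vdm (X :\ x)) *: L x.
(* Q has #|X| roots and smaller degree. *)
have Q0 : Q = 0.
  apply/eqP/negP => /negP Q0.
  have := max_poly_roots Q0 (rs := [seq z x | x in X]).
  rewrite size_image -/s => H.
  have : (s < size Q)%N.
    apply: H; last by rewrite map_inj_uniq ?enum_uniq.
    apply/allP => _ /imageP[x Xx ->]; rewrite /root /Q hornerD hornerN.
    rewrite hornerZ horner_sum (bigD1 x) //= [X in _ - (_ + X)]big1 ?addr0.
      rewrite hornerZ horner_prod (vdmD1 Xx) subr_eq0 mulrC -!mulrA.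
      apply/eqP; congr (_ * (_ * (_ * _))); apply: eq_bigr => y _.
      by rewrite hornerXsubC.
    move=> y /andP[Xy yx]; rewrite hornerZ horner_prod (bigD1 x) /=.
      by rewrite hornerXsubC subrr mul0r mulr0.
    by rewrite !inE eq_sym yx.
  rewrite ltnNge => /negP; apply; apply: leq_trans (size_polyD _ _) _.
  rewrite size_polyN geq_max -{1}sq size_scale_leq /=.
  apply: (big_ind (fun p : {poly R} => size p <= s)%N).
  - by rewrite size_poly0.
  - move=> p1 p2 h1 h2; apply: leq_trans (size_polyD _ _) _.
    by rewrite geq_max h1.
  - by move=> x Xx; apply: leq_trans (size_scale_leq _ _) _; rewrite sL.
have := congr1 (fun p : {poly R} => p`_s.-1) Q0.
rewrite /Q coefB coefZ coef0 coef_sum -{1}sq -/(lead_coef q).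
rewrite (monicP qm) mulr1 => /eqP; rewrite subr_eq0 => /eqP ->.
apply: eq_bigr => x Xx; rewrite coefZ -{1}(sL x Xx) -/(lead_coef (L x)).
by rewrite (monicP (Lm x)) mulr1.
Qed.

(** Interpolating the product of the [z x - z y], [y] in [Y], turns the
    Vandermonde product on [Y] into the one on [x |: Y]; the power of [z x]
    brings this product up to degree [#|X| - 1]. *)
Lemma vdm_exchange (zinj : injective z) X Y : [disjoint X & Y] ->
  (#|Y| < #|X|)%N ->
  vdm X * vdm Y =
  \sum_(x in X) z x ^+ (#|X| - #|Y|.+1) * vdm_sign X x * vdm_sign (x |: Y) x *
     (vdm (X :\ x) * vdm (x |: Y)).
Proof.
move=> dXY lt.
pose q : {poly R} := 'X^(#|X| - #|Y|.+1) * \prod_(y in Y) ('X - (z y)%:P).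
have qm : q \is monic by rewrite monicMl ?monicXn ?monic_prod_XsubC.
have sq : size q = #|X|.
  rewrite size_monicM ?monicXn ?monic_neq0 ?monic_prod_XsubC //.
  by rewrite size_polyXn -big_enum size_prod_XsubC -cardE addnS /= subnSK ?subnK //
    ltnW.
rewrite (vdm_lagrange zinj qm sq) mulr_suml; apply: eq_bigr => x Xx.
have Yx : x \notin Y by rewrite (disjointFr dXY Xx).
have YE : (x |: Y) :\ x = Y by rewrite setU1K.
have /vdmD1 -> : x \in x |: Y by rewrite setU11.
rewrite YE hornerM hornerXn horner_prod.
under eq_bigr do rewrite hornerXsubC.
set S := vdm_sign _ x; set S' := vdm_sign _ x.
have S'K : S' * S' = 1 by apply: vdm_signK.
rewrite -[LHS]mulr1 -S'K; ring.
Qed.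
End Vandermonde.

(** * Prescribing the sizes of the colour classes *)

Section Balance.
Variables (K : fieldType) (m k : nat).
Implicit Types (chi : 'I_m -> 'I_k) (x : 'I_m) (a b c : 'I_k).

Definition color_class chi c : {set 'I_m} := [set i | chi i == c].

Definition recolor chi x b : 'I_m -> 'I_k :=
  fun i => if i == x then b else chi i.

Let X (i : 'I_m) : {mpoly K[m]} := 'X_i.

Lemma mpolyXU_inj : injective X.
Proof.
move=> i j /(congr1 (mcoeff U_(i)))/eqP; rewrite /X !mcoeffX eqxx.
case: (_ =P U_(i)%MM) => [/mnmP/(_ i)/eqP|_]; last by rewrite oner_eq0.
by rewrite !mnm1E eqxx; case: (j =P i).
Qed.

Lemma color_poly_vdm chi :
  color_poly K chi = \prod_c vdm X (color_class chi c).
Proof.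
rewrite /color_poly -(pair_big_dep (fun=> true)
  (fun i j : 'I_m => (i < j)%N && (chi i == chi j)) (fun i j => X i - X j)) /=.
rewrite (partition_big chi predT) //=; apply: eq_bigr => c _.
apply: eq_big => [i|i /eqP ci]; first by rewrite inE.
by apply: eq_bigl => j; rewrite inE ci andbC eq_sym.
Qed.

Lemma color_class_recolor chi x b c : c != b ->
  color_class (recolor chi x b) c = color_class chi c :\ x.
Proof.
move=> cb; apply/setP => i; rewrite !inE /recolor.
by case: (i =P x) => //= _; rewrite eq_sym (negbTE cb).
Qed.

Lemma color_class_recolor_new chi x b :
  color_class (recolor chi x b) b = x |: color_class chi b.
Proof.
by apply/setP => i; rewrite !inE /recolor; case: (i =P x); rewrite ?eqxx.
Qed.

Lemma color_poly_recolor (I : {mpoly K[m]} -> Prop) chi a b :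
  is_ideal I -> (#|color_class chi b| < #|color_class chi a|)%N ->
  (forall x, x \in color_class chi a -> I (color_poly K (recolor chi x b))) ->
  I (color_poly K chi).
Proof.
move=> Iid lt Irec; have ab : b != a by apply: contraTneq lt => ->; rewrite ltnn.
have split_ab psi : color_poly K psi =
    vdm X (color_class psi a) * vdm X (color_class psi b) *
    \prod_(c | (c != a) && (c != b)) vdm X (color_class psi c).
  by rewrite color_poly_vdm (bigD1 a) //= (bigD1 b) //= mulrA.
rewrite split_ab (vdm_exchange mpolyXU_inj) //; last first.
  rewrite -setI_eq0; apply/eqP/setP => i; rewrite !inE.
  by apply/andP => -[/eqP-> /eqP E]; rewrite E eqxx in ab.
rewrite mulr_suml; apply: ideal_sum => // x xa.
rewrite -mulrA; case: (Iid) => _ _; apply.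
have := Irec x xa; rewrite split_ab color_class_recolor_new.
rewrite color_class_recolor 1?eq_sym //.
set A := \prod_(c | _) _; set B := \prod_(c | _) _.
suff -> : A = B by [].
apply: eq_bigr => c /andP[ca cb]; rewrite color_class_recolor //.
congr vdm; apply/setP => i; rewrite !inE; case: (i =P x) => //= ->.
by rewrite inE in xa; rewrite (eqP xa) eq_sym (negbTE ca).
Qed.

Lemma sum_card_color_class chi : (\sum_c #|color_class chi c| = m)%N.
Proof.
rewrite -[RHS]card_ord -sum1_card (partition_big chi predT) //=.
by apply: eq_bigr => c _; rewrite -sum1_card; apply: eq_bigl => i; rewrite inE.
Qed.

(** While some class [a] is too large, some class [b] is too small; the balance
    of [l] makes [b] smaller than [a], and moving one index from [a] to [b]
    lowers the total excess.  When [#|a| = #|b| + 1] the move only swaps the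
    two sizes, which is what brings the large classes to the right colours. *)
Lemma color_poly_balanced (I : {mpoly K[m]} -> Prop) (l : 'I_k -> nat) :
  is_ideal I -> (\sum_c l c = m)%N -> (forall a b, (l b <= (l a).+1)%N) ->
  (forall chi, (forall c, #|color_class chi c| = l c) -> I (color_poly K chi)) ->
  forall chi, I (color_poly K chi).
Proof.
move=> Iid suml lbal Il chi.
have [N] := ubnP (\sum_c (#|color_class chi c| - l c))%N.
elim: N chi => // N IH chi; rewrite ltnS => leN.
have [a lta|nlta] := pickP (fun a => l a < #|color_class chi a|)%N; last first.
  apply: Il => c; apply/eqP; rewrite eqn_leq.
  have le d : (#|color_class chi d| <= l d)%N by rewrite leqNgt nlta.
  have /eqP := etrans (sum_card_color_class chi) (esym suml).
  have /leqif_sum H : forall i : 'I_k, true ->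
      (#|color_class chi i| <= l i ?= iff (#|color_class chi i| == l i))%N.
    by move=> i _; apply: leqif_eq.
  by rewrite H => /forall_inP/(_ c isT) /eqP ->; rewrite leqnn.
have [b ltb] : exists b, (#|color_class chi b| < l b)%N.
  apply/existsP; apply: contraT => /existsPn H.
  suff : (m < m)%N by rewrite ltnn.
  rewrite -{1}suml -(sum_card_color_class chi).
  rewrite (bigD1 a) //= [X in (_ < X)%N](bigD1 a) //= -addSn leq_add //.
  by apply: leq_sum => c _; rewrite leqNgt.
have ab : b != a by apply: contraTneq ltb => ->; rewrite -leqNgt ltnW.
apply: (@color_poly_recolor I chi a b) => //.
  exact: leq_trans ltb (leq_trans (lbal a b) lta).
move=> x xa; apply: IH; apply: leq_trans leN.
rewrite (bigD1 a) //= [X in (_ < X)%N](bigD1 a) //= -addSn leq_add //.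
  rewrite color_class_recolor 1?eq_sym //.
  move: lta; rewrite (cardsD1 x (color_class chi a)) xa add1n ltnS => lta.
  by rewrite subSn.
apply: leq_sum => c ca; have [->|cb] := eqVneq c b.
  rewrite color_class_recolor_new; apply: (@leq_trans 0) => //.
  rewrite leqn0 subn_eq0 cardsU1; apply: leq_trans ltb.
  by rewrite -add1n leq_add2r leq_b1.
by rewrite color_class_recolor // leq_sub2r // subset_leq_card // subsetDl.
Qed.
End Balance.

(** * Specht polynomials as polynomials of colourings *)

Section SpechtColoring.
Variables (K : fieldType) (m : nat) (la : seq nat).
Hypotheses (la_sorted : sorted geq la) (la_sum : sumn la = m).

Definition col_len (c : nat) : nat := count (fun r => c < r)%N la.

Local Notation k := (head 0%N la).

Lemma nth_le_head i : (nth 0 la i <= k)%N.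
Proof.
case: la la_sorted => [|x s] /=; first by rewrite nth_nil.
move=> /(order_path_min (rev_trans leq_trans))/allP H.
case: i => [|i] //=; have [lt|ge] := ltnP i (size s).
  exact/H/mem_nth.
by rewrite nth_default.
Qed.

Lemma lt_col_len (c r : nat) : (c < nth 0 la r)%N -> (r < col_len c)%N.
Proof.
move=> lt; have ltr : (r < size la)%N.
  by rewrite ltnNge; apply: contraTN lt => /(nth_default 0%N) ->.
rewrite /col_len -{1}(cat_take_drop r.+1 la) count_cat.
suff : all (fun x => c < x)%N (take r.+1 la).
  by rewrite all_count size_takel // => /eqP ->; apply: leq_addr.
apply/(all_nthP 0%N) => i; rewrite size_takel // => ltir; rewrite nth_take //.
apply: leq_trans lt _.
by apply: (sorted_leq_nth (rev_trans leq_trans) leqnn _ la_sorted);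
  rewrite ?inE // (leq_trans ltir).
Qed.

Lemma sum_col_len : (\sum_(c < k) col_len c = m)%N.
Proof.
have lek x : x \in la -> (x <= k)%N.
  by move=> /(nthP 0%N)[i _ <-]; apply: nth_le_head.
rewrite -la_sum /col_len; move: k lek => N.
elim: la => [|x s IH] lek /=.
  by rewrite big1.
rewrite big_split /= IH => [|y ys]; last by apply: lek; rewrite inE ys orbT.
congr (_ + _)%N; rewrite -[RHS](card_ord x) -sum1_card.
rewrite (big_ord_widen N (fun=> 1%N)) ?lek ?inE ?eqxx // [RHS]big_mkcond.
by apply: eq_bigr => c _; case: ltnP.
Qed.

Lemma card_box : #|box la| = m.
Proof.
rewrite card_tagged -la_sum; congr sumn; apply: (@eq_from_nth _ 0%N).
  by rewrite size_map size_enum_ord.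
rewrite size_map size_enum_ord => i lti.
by rewrite (nth_map (Ordinal lti)) ?size_enum_ord // card_ord nth_enum_ord.
Qed.

Lemma col_of_lt (b : box la) : (col_of b < nth 0 la (row_of b))%N.
Proof. exact: ltn_ord. Qed.

Definition box_col (b : box la) : 'I_k :=
  Ordinal (leq_trans (col_of_lt b) (nth_le_head (row_of b))).

Lemma box_inj (b b' : box la) :
  row_of b = row_of b' -> col_of b = col_of b' -> b = b'.
Proof.
case: b b' => [i j] [i' j']; rewrite /row_of /col_of /= => /val_inj E.
by case: _ / E j' => j' /val_inj ->.
Qed.

Lemma enum_set_sorted (A : {set 'I_m}) : sorted ltn [seq val i | i <- enum A].
Proof.
rewrite sorted_map; apply: sorted_filter; first by move=> ? ? ?; apply: ltn_trans.
by rewrite -sorted_map -enumT val_enum_ord iota_ltn_sorted.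
Qed.

Lemma nth_enum_set_lt (A : {set 'I_m}) (x0 : 'I_m) i j :
  (i < #|A|)%N -> (j < #|A|)%N ->
  (nth x0 (enum A) i < nth x0 (enum A) j)%N = (i < j)%N.
Proof.
move=> ltiA ltjA.
have W i' j' : (i' < #|A|)%N -> (j' < #|A|)%N -> (i' < j')%N ->
    (nth x0 (enum A) i' < nth x0 (enum A) j')%N.
  move=> lti ltj lt.
  have := sorted_ltn_nth ltn_trans 0%N (enum_set_sorted A).
  move=> /(_ i' j'); rewrite !inE size_map -cardE => /(_ lti ltj lt).
  by rewrite !(nth_map x0) -?cardE.
have [lt|lt|->] := ltngtP i j; last by rewrite ltnn.
  by rewrite W.
by apply/negbTE; rewrite -leqNgt ltnW // W.
Qed.

(** Filling the columns in increasing order makes every factor of the Specht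
    polynomial agree with a factor of the polynomial of the colouring, sign
    included. *)
Lemma tableau_of_coloring (chi : 'I_m -> 'I_k) :
  (forall c, #|color_class chi c| = col_len c) ->
  exists T : tableau m la,
    (forall b, chi (val T b) = box_col b) /\
    (forall b b', col_of b = col_of b' ->
      (val T b < val T b')%N = (row_of b < row_of b')%N).
Proof.
move=> size_chi.
have prf b : (row_of b < #|color_class chi (box_col b)|)%N.
  by rewrite size_chi lt_col_len // col_of_lt.
pose t b : 'I_m := enum_val (Ordinal (prf b)).
have tE x0 b : t b = nth x0 (enum (color_class chi (box_col b))) (row_of b).
  exact: enum_val_nth.
have tchi b : chi (t b) = box_col b.
  by have := enum_valP (Ordinal (prf b)); rewrite inE => /eqP.
have tlt b b' : col_of b = col_of b' -> (t b < t b')%N = (row_of b < row_of b')%N.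
  move=> E; have Eb : box_col b = box_col b' by apply: val_inj.
  have [x0 _] : exists x0, x0 = t b by exists (t b).
  by rewrite (tE x0 b) (tE x0 b') Eb nth_enum_set_lt // -Eb.
have tinj : injective t.
  move=> b b' E; have Ec : col_of b = col_of b'.
    by have := congr1 val (tchi b); rewrite E tchi => /= ->.
  apply: box_inj => //; apply/eqP; rewrite eqn_leq leqNgt -tlt // E ltnn /=.
  by rewrite leqNgt -tlt // E ltnn.
pose T0 : {ffun box la -> 'I_m} := [ffun b => t b].
have T0P : injectiveb T0 && [forall k, k \in codom T0].
  have inj0 : injective T0 by move=> b b'; rewrite !ffunE => /tinj.
  apply/andP; split; first exact/injectiveP.
  apply/forallP => i; apply: inj_card_onto inj0 _ i.
  by rewrite card_box card_ord.
exists (Sub T0 T0P); rewrite SubK.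
by split=> [b|b b' E]; rewrite !ffunE //; apply: tlt.
Qed.

Lemma specht_poly_coloring (chi : 'I_m -> 'I_k) (T : tableau m la) :
  (forall b, chi (val T b) = box_col b) ->
  (forall b b', col_of b = col_of b' ->
      (val T b < val T b')%N = (row_of b < row_of b')%N) ->
  specht_poly K T = color_poly K chi.
Proof.
move=> Tchi Tlt; have /andP[/injectiveP Tinj _] := valP T.
have [T' TK T'K] : bijective (val T : box la -> 'I_m).
  by apply: inj_card_bij => //; rewrite card_box card_ord.
rewrite /color_poly (partition_big (fun p : 'I_m * 'I_m => chi p.1) predT) //=.
apply: eq_bigr => c _; rewrite /specht_column.
rewrite [RHS](reindex (fun p : box la * box la => (val T p.1, val T p.2))) /=.
  apply: eq_bigl => -[b b'] /=; rewrite !Tchi -!val_eqE /=.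
  apply/and3P/andP => [[/eqP bc /eqP b'c lt]|[/andP[lt /eqP bb'] /eqP bc]].
    by rewrite Tlt ?bc ?b'c // lt !eqxx.
  by rewrite -Tlt // -bb' bc lt eqxx.
exists (fun p => (T' p.1, T' p.2)) => -[i j] _ /=; first by rewrite !TK.
by rewrite !T'K.
Qed.

Lemma specht_ideal_is_ideal : is_ideal (specht_ideal K m la).
Proof.
split=> [|p q [c ->] [e ->]|p q [c ->]].
- by exists (fun=> 0); rewrite big1 // => T _; rewrite mul0r.
- exists (fun T => c T + e T); rewrite -big_split.
  by apply: eq_bigr => T _; rewrite mulrDl.
- exists (fun T => p * c T); rewrite mulr_sumr.
  by apply: eq_bigr => T _; rewrite mulrA.
Qed.

Lemma specht_poly_in (T : tableau m la) : specht_ideal K m la (specht_poly K T).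
Proof.
exists (fun U => if U == T then 1 else 0); rewrite (bigD1 T) //= eqxx mul1r.
by rewrite big1 ?addr0 // => U /negbTE ->; rewrite mul0r.
Qed.

Lemma specht_poly_vanishes (T : tableau m la) :
  vanishes_heavy k (specht_poly K T).
Proof.
move=> v x lt; have /andP[_ /forallP Tonto] := valP T.
pose S := [pred b : box la | v (val T b) == x].
have ltS : (k < #|S|)%N.
  apply: leq_trans lt _; rewrite /multiplicity -(card_image (f := val T)); last first.
    by have /andP[/injectiveP] := valP T.
  apply: subset_leq_card; apply/subsetP => i; rewrite inE => vi.
  have /codomP[b ib] := Tonto i; rewrite ib; apply: image_f.
  by rewrite inE -ib.
have : ~~ dinjectiveb box_col S.
  apply/negP => /dinjectiveP /card_in_image E.
  have := max_card (mem [seq box_col b | b in S]).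
  by rewrite E card_ord leqNgt ltS.
case/dinjectivePn => b Sb [b']; rewrite !inE in Sb * => /andP[nbb' Sb'] cbb'.
have {}cbb' : col_of b = col_of b' by have := congr1 val cbb'.
wlog ltbb' : b b' Sb Sb' nbb' cbb' / (row_of b < row_of b')%N.
  move=> W; have [] := ltngtP (row_of b) (row_of b'); first exact: W.
    by move=> lt'; apply: (W b' b) => //; rewrite eq_sym.
  by move=> E; rewrite (box_inj E cbb') eqxx in nbb'.
rewrite /specht_poly (bigD1 (box_col b)) //= /specht_column.
rewrite (bigD1 (b, b')) /= ?ltbb' ?cbb' ?eqxx //.
by rewrite !mevalM mevalB !mevalXU (eqP Sb) (eqP Sb') subrr !mul0r.
Qed.

(** The balance of the column lengths is essential here: without it the Specht
    polynomials vanish at further points. *)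
Theorem specht_idealE (Kinf : infinite_field K) :
  (forall a b : 'I_k, (col_len b <= (col_len a).+1)%N) ->
  forall p, specht_ideal K m la p <-> vanishes_heavy k p.
Proof.
move=> bal p; split=> [[c ->]|].
  have Vid : is_ideal (@vanishes_heavy K m k) by apply: ideal_vanishes_heavy.
  apply: ideal_sum => // T _; have [_ _] := Vid; apply.
  exact: specht_poly_vanishes.
have Sid := specht_ideal_is_ideal.
apply: vanishes_heavy_color => //.
apply: (color_poly_balanced Sid sum_col_len bal) => chi size_chi.
have [T [Tchi Tlt]] := tableau_of_coloring size_chi.
by rewrite -(specht_poly_coloring Tchi Tlt); apply: specht_poly_in.
Qed.
End SpechtColoring.

(** * Expansion in the last variable *)

Section LastVariable.
Variables (K : fieldType) (n : nat).
Implicit Types (p q a b : {mpoly K[n]}) (f g : {mpoly K[n.+1]}).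

Local Notation widen := (widen_ord (leqnSn n)).
Local Notation y := ('X_(@ord_max n) : {mpoly K[n.+1]}).

Lemma mdeg_mnmwiden (u : 'X_{1..n}) : mdeg (mnmwiden u) = mdeg u.
Proof.
rewrite !mdegE big_ord_recr /= mnmwiden_ordmax addn0.
by apply: eq_bigr => i _; rewrite mnmwiden_widen.
Qed.

Lemma mwiden_sumE p : mwiden p = \sum_(u <- msupp p) p@_u *: 'X_[mnmwiden u].
Proof.
rewrite {1}[p]mpolyE raddf_sum /=.
by apply: eq_bigr => u _; rewrite mwidenZ mwidenX.
Qed.

Lemma dhomog_mwiden p e : p \is e.-homog -> mwiden p \is e.-homog.
Proof.
move=> /dhomogP hp; rewrite mwiden_sumE big_seq; apply: rpred_sum => u up.
by apply: rpredZ; rewrite dhomogX /= mdeg_mnmwiden; apply/eqP/hp.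
Qed.

Lemma pihomog_mwiden p e : pihomog mdeg e (mwiden p) = mwiden (pihomog mdeg e p).
Proof.
rewrite mwiden_sumE linear_sum /= pihomogE raddf_sum /= [RHS]big_mkcond.
apply: eq_bigr => u _; rewrite linearZ /= pihomogX /= mdeg_mnmwiden.
by case: ifP => _; rewrite ?scaler0 // mwidenZ mwidenX.
Qed.

Definition mnmrestr (u : 'X_{1..n.+1}) : 'X_{1..n} :=
  [multinom u (widen i) | i < n].

Lemma mnmrestrK u : (mnmwiden (mnmrestr u) + U_(ord_max) *+ u ord_max)%MM = u.
Proof.
apply/mnmP => i; rewrite mnmDE mulmnE mnm1E.
have [->|nmax] := eqVneq i ord_max.
  by rewrite mnmwiden_ordmax ?eqxx mul1n.
have lt : (i < n)%N by rewrite ltn_neqAle -ltnS ltn_ord andbT.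
have -> : i = widen (Ordinal lt) by apply: val_inj.
by rewrite mnmwiden_widen mnmE mul0n addn0.
Qed.

Lemma mdeg_mnmrestr u : (mdeg (mnmrestr u) + u ord_max = mdeg u)%N.
Proof.
rewrite -{3}(mnmrestrK u) mdegD mdeg_mnmwiden; congr (_ + _)%N.
by rewrite mdegMn mdeg1 mul1n.
Qed.

Lemma muniX u : muni ('X_[u] : {mpoly K[n.+1]}) = 'X_[mnmrestr u] *: 'X^(u ord_max).
Proof. by rewrite muniE msuppX big_seq1 mcoeffX eqxx scale1r. Qed.

Lemma muni_mwiden p : muni (mwiden p) = p%:P.
Proof.
transitivity (\sum_(u <- msupp p) (p@_u *: 'X_[u])%:P); last first.
  by rewrite -raddf_sum -mpolyE.
rewrite mwiden_sumE raddf_sum /=.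
apply: eq_bigr => u _; rewrite muniZ muniX mnmwiden_ordmax expr0.
rewrite -mul_mpolyC polyCM -!mul_polyC mulr1; congr (_ * 'X_[_]%:P).
by apply/mnmP => i; rewrite mnmE mnmwiden_widen.
Qed.

Lemma muni_y : muni y = 'X.
Proof.
rewrite muniX mnm1E eqxx expr1 (_ : mnmrestr _ = 0%MM) ?mpolyX0 ?scale1r //.
by apply/mnmP => i; rewrite mnmE mnm1E mnm0E -val_eqE /= gtn_eqF.
Qed.

Lemma muni_yXn_mwiden p N : muni (y ^+ N * mwiden p) = p *: 'X^N.
Proof. by rewrite muniM rmorphXn /= muni_y muni_mwiden mulrC mul_polyC. Qed.

Lemma muniK f : (map_poly (@mwiden n K) (muni f)).[y] = f.
Proof.
rewrite {2}[f]mpolyE muniE rmorph_sum /= horner_sum; apply: eq_bigr => u _.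
rewrite map_polyZ /= map_polyXn hornerZ hornerXn mwidenZ mwidenX.
rewrite -scalerAl mpolyXn -mpolyXD; congr (_ *: 'X_[_]); exact: mnmrestrK.
Qed.

Lemma meval_muni f (w : 'I_n.+1 -> K) :
  f.@[w] = (map_poly (meval (fun i => w (widen i))) (muni f)).[w ord_max].
Proof.
rewrite -{1}(muniK f) -horner_map /= mevalXU -map_poly_comp.
congr (_.[_]); apply: eq_map_poly => p /=.
rewrite mwiden_sumE raddf_sum mevalE /=; apply: eq_bigr => u _.
rewrite mevalZ mevalX big_ord_recr /= mnmwiden_ordmax expr0 mulr1.
by congr (_ * _); apply: eq_bigr => i _; rewrite mnmwiden_widen.
Qed.

Lemma meval_mwiden p (w : 'I_n.+1 -> K) :
  (mwiden p).@[w] = p.@[fun i => w (widen i)].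
Proof. by rewrite meval_muni muni_mwiden map_polyC hornerC. Qed.

Lemma dhomog_muni_coef f i j : f \is i.-homog -> (j <= i)%N ->
  (muni f)`_j \is (i - j).-homog.
Proof.
move=> /dhomogP hf ji; rewrite muniE coef_sum big_seq; apply: rpred_sum => u uf.
rewrite coefZ coefXn; case: eqP => [->|_]; last by rewrite mulr0 rpred0.
rewrite mulr1; apply: rpredZ; rewrite dhomogX -(hf u uf) /=.
by rewrite -(mdeg_mnmrestr u) addnK.
Qed.

Lemma size_muni_dhomog f i : f \is i.-homog -> (size (muni f) <= i.+1)%N.
Proof.
move=> /dhomogP hf; apply/leq_sizeP => j ij.
rewrite muniE coef_sum big1_seq // => u /andP[_ uf].
rewrite coefZ coefXn gtn_eqF ?mulr0 //; apply: leq_trans ij.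
by rewrite ltnS -(hf u uf) /= -(mdeg_mnmrestr u) leq_addl.
Qed.

(** * Dimension count by the degree in the last variable *)

(** [quot_dim_is] for an arbitrary class [C] of polynomials in place of the
    homogeneous polynomials of a given degree. *)
Definition rel_dim_is (I C : {mpoly K[n.+1]} -> Prop) h : Prop :=
  exists b : 'I_h -> {mpoly K[n.+1]},
    [/\ forall k, C (b k),
        forall c : 'I_h -> K, I (\sum_k c k *: b k) -> forall k, c k = 0
      & forall f, C f -> exists c : 'I_h -> K, I (f - \sum_k c k *: b k)].

Lemma quot_dim_isP m (I : {mpoly K[m]} -> Prop) i :
  is_ideal I -> quot_dim_is I i (quot_dim I i).
Proof.
case=> I0 ID IM; apply/(quot_dimP I0 ID) => // a p Ip.
by rewrite -mul_mpolyC; apply: IM.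
Qed.

Section Recursion.
Variables (I : {mpoly K[n.+1]} -> Prop) (J A : {mpoly K[n]} -> Prop).
Hypotheses (Iid : is_ideal I) (Jid : is_ideal J) (Aid : is_ideal A).
Hypothesis IJ : forall p, I (mwiden p) <-> J p.
Hypothesis IA : forall f j, I f -> A (muni f)`_j.
Hypothesis AI : forall a e, A a -> a \is e.-homog ->
  exists2 b, b \is e.+1.-homog & I (y * mwiden a + mwiden b).

Let low_degree i N f := f \is i.-homog /\ (size (muni f) <= N.+1)%N.

Lemma rel_dim0 i : rel_dim_is I (low_degree i 0) (quot_dim J i).
Proof.
have [b [bh bf bs]] := quot_dim_isP i Jid.
have sumE c : \sum_k c k *: mwiden (b k) = mwiden (\sum_k c k *: b k).
  by rewrite raddf_sum /=; apply: eq_bigr => k _; rewrite mwidenZ.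
exists (fun k => mwiden (b k)); split=> [k|c|f [fh sf]].
- split; first exact: dhomog_mwiden.
  by rewrite muni_mwiden size_polyC leq_b1.
- by rewrite sumE => /IJ/bf.
have fE : f = mwiden (muni f)`_0.
  by rewrite -{1}(muniK f) {1}(size1_polyC sf) map_polyC hornerC.
have [|c Jc] := bs (muni f)`_0.
  by have := dhomog_muni_coef fh (leq0n i); rewrite subn0.
by exists c; rewrite fE sumE -mwidenB; apply/IJ.
Qed.

(** The new basis elements are [y ^+ N.+1] times a basis modulo [A].  They are
    independent of the old ones by [IA], and they suffice by [AI]: modulo [I],
    a coefficient of [y ^+ N.+1] that lies in [A] can be traded for terms of
    lower degree in [y]. *)
Lemma rel_dimS i N h : (N < i)%N ->
  rel_dim_is I (low_degree i N) h ->
  rel_dim_is I (low_degree i N.+1) (h + quot_dim A (i - N.+1)).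
Proof.
move=> ltN [b [bC bf bs]]; set h' := quot_dim A _.
have [e [eh ef es]] := quot_dim_isP (i - N.+1) Aid; rewrite -/h' in e eh ef es.
have [I0 ID IM] := Iid.
pose t k := y ^+ N.+1 * mwiden (e k).
pose bb k := match split k with inl k1 => b k1 | inr k2 => t k2 end.
have bbl k : bb (lshift h' k) = b k by rewrite /bb (unsplitK (inl k)).
have bbr k : bb (rshift h k) = t k by rewrite /bb (unsplitK (inr k)).
have bbE c : \sum_k c k *: bb k = (\sum_k c (lshift h' k) *: b k) +
    y ^+ N.+1 * mwiden (\sum_k c (rshift h k) *: e k).
  rewrite big_split_ord /=; congr (_ + _).
    by apply: eq_bigr => k _; rewrite bbl.
  rewrite raddf_sum /= mulr_sumr; apply: eq_bigr => k _.
  by rewrite bbr mwidenZ scalerAr.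
have yh p d j : p \is d.-homog -> y ^+ j * mwiden p \is (j + d).-homog.
  move=> hp; apply: dhomogM; last exact: dhomog_mwiden.
  have /(dhomogMn j) : y \is 1.-homog by rewrite dhomogX /= mdeg1.
  by rewrite mul1n.
have szt p j : (size (p *: 'X^j : {poly {mpoly K[n]}}) <= j.+1)%N.
  by apply: leq_trans (size_scale_leq _ _) _; rewrite size_polyXn.
exists bb; split=> [k|c Ic k|f [fh sf]].
- rewrite /bb; case: split => [k1|k2].
    by have [bh sb] := bC k1; split=> //; apply: leqW.
  split; last by rewrite muni_yXn_mwiden szt.
  by have := yh _ _ N.+1 (eh k2); rewrite subnKC.
- rewrite bbE in Ic; have c2 : forall k2, c (rshift h k2) = 0.
    apply: ef; have := IA N.+1 Ic; rewrite muniD coefD muni_yXn_mwiden.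
    rewrite coefZ coefXn eqxx mulr1 raddf_sum /= coef_sum big1 ?add0r // => k1 _.
    rewrite muniZ coefZ (leq_sizeP _ _ (bC k1).2) ?mulr0 //.
  move: Ic; rewrite [X in mwiden X]big1 => [|k2 _]; last by rewrite c2 scale0r.
  rewrite mwiden0 mulr0 addr0 => /(bf (fun k1 => c (lshift h' k1))) c1.
  by case: (split_ordP k) => k' ->.
pose q := (muni f)`_N.+1.
have qh : q \is (i - N.+1).-homog by apply: dhomog_muni_coef.
have [c2 Ac2] := es q qh; set a := q - _ in Ac2.
have ah : a \is (i - N.+1).-homog.
  rewrite /a; apply: rpredB => //; apply: rpred_sum => k _; exact: dhomogZ.
have [b' b'h Ib'] := AI Ac2 ah.
have [|c1 Ic1] := bs (f - y ^+ N.+1 * mwiden q - y ^+ N * mwiden b').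
  split.
    apply: rpredB; first apply: rpredB => //.
      by have := yh _ _ N.+1 qh; rewrite subnKC.
    by have := yh _ _ N b'h; rewrite -subSn // subSS subnKC // ltnW.
  rewrite !muniB !muni_yXn_mwiden; apply/leq_sizeP => j.
  rewrite leq_eqVlt !coefB !coefZ !coefXn => /predU1P[<-|lt].
    by rewrite eqxx mulr1 subrr gtn_eqF // mulr0 subr0.
  rewrite !gtn_eqF // ?mulr0 ?subr0; last exact: ltn_trans lt.
  by apply: (leq_sizeP _ _ sf).
exists (fun k => match split k with inl k1 => c1 k1 | inr k2 => c2 k2 end).
rewrite bbE.
rewrite (eq_bigr (fun k => c1 k *: b k)); last first.
  by move=> k _; rewrite (unsplitK (inl k)).
rewrite [X in mwiden X](eq_bigr (fun k => c2 k *: e k)); last first.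
  by move=> k _; rewrite (unsplitK (inr k)).
have -> : f - (\sum_k c1 k *: b k + y ^+ N.+1 * mwiden (\sum_k c2 k *: e k)) =
   (f - y ^+ N.+1 * mwiden q - y ^+ N * mwiden b' - \sum_k c1 k *: b k) +
   y ^+ N * (y * mwiden a + mwiden b').
  rewrite /a mwidenB exprSr.
  move: (mwiden _) (mwiden _) (mwiden _) (y ^+ N) => P1 P2 P3 P4.
  by ring.
by apply: ID => //; apply: IM.
Qed.

Lemma quot_dim_recursion i :
  quot_dim I i = (quot_dim J i + \sum_(j < i) quot_dim A j)%N.
Proof.
have [I0 ID IM] := Iid.
apply/(quot_dimP I0 ID); first by move=> c p Ip; rewrite -mul_mpolyC; apply: IM.
have H N : (N <= i)%N -> rel_dim_is I (low_degree i N)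
    (quot_dim J i + \sum_(j < N) quot_dim A (i - j.+1)).
  elim: N => [_|N IH lt]; first by rewrite big_ord0 addn0; apply: rel_dim0.
  by rewrite big_ord_recr /= addnA; apply: rel_dimS => //; apply/IH/ltnW.
have [b [bC bf bs]] := H i (leqnn i).
rewrite (reindex_inj rev_ord_inj) /=.
exists b; split=> [k||p ph]; [by case: (bC k) | exact: bf |].
by apply: bs; split=> //; apply: size_muni_dhomog.
Qed.
End Recursion.
End LastVariable.

(** * Heavy points and the last variable *)

Section HeavyLastVariable.
Variables (K : fieldType) (Kinf : infinite_field K) (n k : nat).
Implicit Types (p a b : {mpoly K[n]}) (f : {mpoly K[n.+1]}).

Local Notation widen := (widen_ord (leqnSn n)).
Local Notation y := ('X_(@ord_max n) : {mpoly K[n.+1]}).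

Definition extend (v : 'I_n -> K) (t : K) (i : 'I_n.+1) : K :=
  if insub (val i) is Some j then v j else t.

Lemma extend_widen v t i : extend v t (widen i) = v i.
Proof. by rewrite /extend valK. Qed.

Lemma extend_max v t : extend v t ord_max = t.
Proof. by rewrite /extend insubF //= ltnn. Qed.

Lemma multiplicityS (w : 'I_n.+1 -> K) x :
  multiplicity w x = (multiplicity (fun i => w (widen i)) x + (w ord_max == x))%N.
Proof.
rewrite /multiplicity -!sum1_card !big_mkcond big_ord_recr /=; congr (_ + _)%N.
by rewrite [RHS]big_mkcond.
Qed.

(** A heavy value can be repeated once more in the last coordinate; conversely
    dropping a coordinate loses at most one occurrence. *)
Lemma vanishes_heavy_mwiden p :
  vanishes_heavy k.+1 (mwiden p) <-> vanishes_heavy k p.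
Proof.
split=> Vp v x lt.
  have := Vp (extend v x) x.
  rewrite meval_mwiden multiplicityS extend_max eqxx addn1.
  have E : (fun i => extend v x (widen i)) =1 v by move=> i; apply: extend_widen.
  by rewrite (meval_eq _ E) (eq_multiplicity x E); apply.
rewrite meval_mwiden; apply: (Vp _ x); move: lt; rewrite multiplicityS.
by case: (_ == x); rewrite ?addn1 ?addn0 // => /ltnW.
Qed.

(** A polynomial in the last coordinate that vanishes at infinitely many values
    is zero. *)
Lemma vanishes_heavy_muni_coef f j :
  vanishes_heavy k f -> vanishes_heavy k (muni f)`_j.
Proof.
move=> Vf v x lt; rewrite -coef_map.
have [->|/(infinite_field_nonroot Kinf [::])[t _]] :=
  eqVneq (map_poly (meval v) (muni f)) 0; first by rewrite coef0.
have := meval_muni f (extend v t); rewrite extend_max.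
have E : (fun i => extend v t (widen i)) =1 v by move=> i; apply: extend_widen.
rewrite (eq_map_poly (g := meval v)) => [<-|p]; last exact: meval_eq.
by rewrite (Vf _ x) ?eqxx // multiplicityS (eq_multiplicity x E) ltn_addr.
Qed.

Lemma color_poly_extend (chi : 'I_n -> 'I_k) (c : 'I_k) :
  color_poly K (fun i : 'I_n.+1 => if insub (val i) is Some j then chi j else c) =
  mwiden (color_poly K chi) * \prod_(i in color_class chi c) (mwiden 'X_i - y).
Proof.
set chi' := fun i : 'I_n.+1 => _.
have chiw i : chi' (widen i) = chi i by rewrite /chi' valK.
have chim : chi' ord_max = c by rewrite /chi' insubF //= ltnn.
have Xw i : mwiden ('X_i : {mpoly K[n]}) = 'X_(widen i).
  by rewrite mwidenX mnmwiden1.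
rewrite /color_poly rmorph_prod /=.
rewrite -(pair_big_dep (fun=> true)
  (fun i j : 'I_n.+1 => (i < j)%N && (chi' i == chi' j)) (fun i j => 'X_i - 'X_j)) /=.
rewrite -(pair_big_dep (fun=> true)
  (fun i j : 'I_n => (i < j)%N && (chi i == chi j))
  (fun i j => mwiden ('X_i - 'X_j))) /=.
rewrite big_ord_recr /= [X in _ * X]big1 ?mulr1; last first.
  by move=> j; rewrite ltnNge -ltnS ltn_ord.
rewrite [X in _ * X]big_mkcond -big_split /=; apply: eq_bigr => i _.
rewrite big_mkcond big_ord_recr /= chim chiw inE ltn_ord; congr (_ * _).
  rewrite [RHS]big_mkcond; apply: eq_bigr => j _; rewrite chiw.
  by case: ifP => _ //; rewrite mwidenB !Xw.
by rewrite /= Xw.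
Qed.

(** If [a] is the polynomial of a colouring whose class [c0] is a singleton
    [{i}], then giving the last variable the colour [c0] multiplies [a] by
    ['X_i - y], and the product vanishes at heavy points by pigeonhole.  Such
    colourings generate all of [vanishes_heavy k]. *)
Lemma vanishes_heavy_lift (l : 'I_k -> nat) (c0 : 'I_k) :
  (\sum_c l c = n)%N -> (forall c c', (l c' <= (l c).+1)%N) -> l c0 = 1%N ->
  forall a, vanishes_heavy k a ->
    exists b, vanishes_heavy k (y * mwiden a + mwiden b).
Proof.
move=> suml bal l1.
have [V0 VD VM] := @ideal_vanishes_heavy K n.+1 k.
pose liftable a := exists b, vanishes_heavy k (y * mwiden a + mwiden b).
have lift_id : is_ideal liftable.
  split=> [|a a' [b Vb] [b' Vb']|p a [b Vb]].
  - by exists 0; rewrite !mwiden0 mulr0 addr0.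
  - by exists (b + b'); rewrite !mwidenD mulrDr addrACA; apply: VD.
  - by exists (p * b); rewrite !mwidenM mulrCA -mulrDr; apply: VM.
apply: (vanishes_heavy_color Kinf lift_id).
apply: (color_poly_balanced lift_id suml bal).
move=> chi sz; have /eqP/cards1P[i iE] : #|color_class chi c0| = 1%N.
  by rewrite sz.
exists (- ('X_i * color_poly K chi)).
have := @color_poly_vanishes K _ _
  (fun i : 'I_n.+1 => if insub (val i) is Some j then chi j else c0).
rewrite color_poly_extend iE big_set1 => /(VM (-1)).
by rewrite mulN1r mulrBr opprB mwidenN mwidenM mulrC [mwiden 'X_i * _]mulrC.
Qed.
End HeavyLastVariable.

(** * The recursion for Hilbert series *)

Lemma fps_mul_shift_geom (h : fps) i :
  fps_mul (fps_mul fps_t fps_geom) h i = \sum_(j < i) h j.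
Proof.
have tg j : fps_mul fps_t fps_geom j = (0 < j)%N%:R.
  rewrite /fps_mul /fps_t /fps_geom; case: j => [|j]; first by rewrite big_ord1.
  by rewrite 2!big_ord_recl /= big1 => [|l _]; rewrite ?mulr1 ?addr0 ?add0r.
move: (fps_mul fps_t fps_geom) tg => g tg; rewrite /fps_mul.
rewrite (eq_bigr (fun j : 'I_i.+1 => (0 < j)%N%:R * h (i - j)%N)) => [|j _].
  rewrite big_ord_recl mul0r add0r (reindex_inj rev_ord_inj) /=.
  apply: eq_bigr => j _; rewrite mul1r; congr h.
  by rewrite /bump /= add1n subnSK // subKn // ltnW.
by rewrite tg.
Qed.

Lemma hilbert_heavy (K : fieldType) (Kinf : infinite_field K) (n k : nat)
    (I : {mpoly K[n.+1]} -> Prop) (J A : {mpoly K[n]} -> Prop)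
    (l : 'I_k.+1 -> nat) (c0 : 'I_k.+1) :
  (forall f, I f <-> vanishes_heavy k.+1 f) ->
  (forall p, J p <-> vanishes_heavy k p) ->
  (forall p, A p <-> vanishes_heavy k.+1 p) ->
  (\sum_c l c = n)%N -> (forall c c', (l c' <= (l c).+1)%N) -> l c0 = 1%N ->
  hilbert_series I =1
    fps_add (hilbert_series J)
      (fps_mul (fps_mul fps_t fps_geom) (hilbert_series A)).
Proof.
move=> IE JE AE suml bal l1.
have id_eq m (B B' : {mpoly K[m]} -> Prop) :
    (forall p, B p <-> B' p) -> is_ideal B' -> is_ideal B.
  move=> E [B0 BD BM]; split=> [|p q /E Bp /E Bq|p q /E Bq]; apply/E => //.
    exact: BD.
  exact: BM.
have Iid := id_eq _ _ _ IE (@ideal_vanishes_heavy K n.+1 k.+1).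
have Jid := id_eq _ _ _ JE (@ideal_vanishes_heavy K n k).
have Aid := id_eq _ _ _ AE (@ideal_vanishes_heavy K n k.+1).
move=> i; rewrite /hilbert_series /fps_add (quot_dim_recursion Iid Jid Aid); first last.
- move=> a e /AE Va ah.
  have [b Vb] := vanishes_heavy_lift Kinf suml bal l1 Va.
  exists (pihomog mdeg e.+1 b); first exact: pihomogP.
  apply/IE; have := vanishes_heavy_pihomog Kinf e.+1 Vb.
  rewrite pihomogD pihomog_mwiden pihomog_dE //.
  rewrite -[e.+1]add1n; apply: dhomogM; last exact: dhomog_mwiden.
  by rewrite dhomogX /= mdeg1.
- by move=> f j /IE Vf; apply/AE; apply: vanishes_heavy_muni_coef.
- move=> p; apply: iff_trans (IE _) _; apply: iff_trans (iff_sym (JE p)).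
  exact: vanishes_heavy_mwiden.
rewrite PoszD fps_mul_shift_geom; congr (_ + _).
exact: (big_morph Posz PoszD (erefl _)).
Qed.

Theorem corollary4p4 (K : fieldType) (Kinf : infinite_field K) (n d : nat) :
  ((d < n - d)%N -> (2 <= d)%N ->
    hilbert_series (specht_ideal K n [:: n - d; d]%N) =1
      fps_add
        (hilbert_series (specht_ideal K n.-1 [:: n - d - 1; d]%N))
        (fps_mul (fps_mul fps_t fps_geom)
          (hilbert_series (specht_ideal K n.-1 [:: n - d; d - 1]%N))))
  /\
  (n = (2 * d)%N -> (2 <= d)%N ->
    hilbert_series (specht_ideal K n [:: d; d]%N) =1
      fps_add
        (hilbert_series (specht_ideal K n.-1 [:: d - 1; d - 1; 1]%N))
        (fps_mul (fps_mul fps_t fps_geom)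
          (hilbert_series (specht_ideal K n.-1 [:: d; d - 1]%N)))).
Proof.
have two_row m a b : (0 < a)%N -> (b <= a)%N -> (a + b = m)%N ->
    forall p, specht_ideal K m [:: a; b] p <-> vanishes_heavy a p.
  move=> a0 ba ab; apply: (specht_idealE _ _ Kinf).
  - by rewrite /= /geq /= ba.
  - by rewrite /= addn0.
  move=> c c'; rewrite /col_len /= !ltn_ord addn0.
  by rewrite !add1n ltnS addn0; apply: leq_trans (leq_b1 _) _.
have rec m k b (I : {mpoly K[m.+1]} -> Prop) (J : {mpoly K[m]} -> Prop) :
    (b <= k)%N -> (k.+1 + b = m)%N ->
    (forall f, I f <-> vanishes_heavy k.+1 f) ->
    (forall p, J p <-> vanishes_heavy k p) ->
    hilbert_series I =1 fps_add (hilbert_series J)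
      (fps_mul (fps_mul fps_t fps_geom)
         (hilbert_series (specht_ideal K m [:: k.+1; b]))).
  move=> bk mE IE JE.
  have bal (c c' : 'I_k.+1) :
      (col_len [:: k.+1; b] c' <= (col_len [:: k.+1; b] c).+1)%N.
    rewrite /col_len /= !ltn_ord !addn0.
    by rewrite !add1n ltnS; apply: leq_trans (leq_b1 _) _.
  (* The last column of (k + 1, b) has one box since b <= k. *)
  apply: (hilbert_heavy Kinf IE JE _ _ bal (c0 := ord_max)).
  - by apply: two_row => //; apply: leqW.
  - apply: (@sum_col_len m [:: k.+1; b]); first by rewrite /= /geq /= leqW.
    by rewrite /= addn0.
  - by rewrite /col_len /= ltnSn ltnNge bk.
split=> [lt d2|nE d2].
  have [k kE] : exists k, (n - d)%N = k.+1 by case: (n - d)%N lt => // k; exists k.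
  have [b dE] : exists b, d = b.+1 by case: d d2 {lt kE} => // b; exists b.
  have nE : n = (k.+1 + b).+1 by lia.
  rewrite kE dE nE !subn1 /=; apply: rec; rewrite ?addSn //; first by lia.
    by apply: two_row; lia.
  by apply: two_row; lia.
have [k dE] : exists k, d = k.+2 by case: d d2 {nE} => [|[|k]] //; exists k.
have {}nE : n = (k.+2 + k.+1).+1 by lia.
rewrite nE dE !subn1 /=; apply: rec; rewrite ?addSn //.
  by apply: two_row; lia.
apply: (specht_idealE _ _ Kinf).
- by rewrite /= /geq /= leqnn.
- by rewrite /=; lia.
move=> c c'; rewrite /col_len /= !ltn_ord !add1n !addn0 !ltnS.
by apply: leq_trans (leq_b1 _) _.
Qed.
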